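(* Let $N \ge 1$ and $m \ge 2$ be integers. For an arbitrary sequence of nested sets $\mathscr{B}_1 \supset \mathscr{B}_2 \supset \cdots \supset \mathscr{B}_m$ with $\mathrm{vol}(\mathscr{B}_1) = V_{\max}$ and $\mathrm{vol}(\mathscr{B}_m) = V_{\min}$, where $0 < V_{\min} < V_{\max} < \infty$, let $\mathbf{n}_2, \ldots, \mathbf{n}_m$ be the numbers of original samples in the sample reuse algorithm with sample size $N$. Let $\boldsymbol{P}$ be a Poisson random variable with mean $\lambda = N \ln\left(\frac{V_{\max}}{V_{\min}}\right)$. Then $$\Pr\left\{\sum_{\ell=2}^m \mathbf{n}_\ell = 0\right\} = \Pr\{\boldsymbol{P} = 0\},$$ and $$\Pr\left\{\sum_{\ell=2}^m \mathbf{n}_\ell \le k\right\} > \Pr\{\boldsymbol{P} \le k\} \quad \text{for every positive integer } k.$$ Moreover, with $N$, $V_{\max}$, $V_{\min}$ fixed, as the maximum difference of volumes of consecutive sets $\max_{2 \le \ell \le m}\left(\mathrm{vol}(\mathscr{B}_{\ell-1}) - \mathrm{vol}(\mathscr{B}_\ell)\right)$ tends to zero (along any sequence of such nested families, with $m$ allowed to vary), $\sum_{\ell=2}^m \mathbf{n}_\ell$ converges to $\boldsymbol{P}$ in distribution.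
   Context: The sets $\mathscr{B}_\ell$ are measurable subsets of a Euclidean space and $\mathrm{vol}$ denotes Lebesgue measure. All random variables are defined on a common probability space $(\Omega, \mathscr{F}, \Pr)$. Sample reuse function $\mathscr{G}$: given random variables $X_1, \ldots, X_a$ with values in $\mathscr{A}$ and $Y_1, \ldots, Y_b$ with values in $\mathscr{B}$, where $a \le b$ and $\mathscr{A} \supset \mathscr{B}$, let $\mathbf{k}(\omega)$ be the number of indices $i \in \{1, \ldots, a\}$ with $X_i(\omega) \in \mathscr{B}$, and let $i_1 < \cdots < i_{\mathbf{k}(\omega)}$ be these indices. Put $Z_\ell(\omega) = X_{i_\ell}(\omega)$ for $1 \le \ell \le \mathbf{k}(\omega)$ and $Z_\ell(\omega) = Y_\ell(\omega)$ for $\mathbf{k}(\omega) < \ell \le b$. Write $(Z_1, \ldots, Z_b; \mathbf{k}) = \mathscr{G}(X_1, \ldots, X_a; Y_1, \ldots, Y_b)$. Sample reuse algorithm with sample size $N$: let $X_{\ell,i}$, $1 \le \ell \le m$, $1 \le i \le N$, be mutually independent, with $X_{\ell,i}$ uniformly distributed over $\mathscr{B}_\ell$. Let $Y_{1,i} = X_{1,i}$ for $i = 1, \ldots, N$, and for $\ell = 2, \ldots, m$ let $$(Y_{\ell,1}, \ldots, Y_{\ell,N}; \mathbf{k}_\ell) = \mathscr{G}(Y_{\ell-1,1}, \ldots, Y_{\ell-1,N}; X_{\ell,1}, \ldots, X_{\ell,N}),$$ where $\mathscr{G}$ is applied with $\mathscr{A} = \mathscr{B}_{\ell-1}$ and $\mathscr{B}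 = \mathscr{B}_\ell$. The number of original samples at stage $\ell$ is $\mathbf{n}_\ell = N - \mathbf{k}_\ell$, $\ell = 2, \ldots, m$. *)

(* Defs.v *)
From HB Require Import structures.
From mathcomp Require Import all_boot all_order all_algebra.
From mathcomp Require Import all_classical all_reals all_analysis.

Set Implicit Arguments.
Unset Strict Implicit.
Unset Printing Implicit Defensive.

Import Order.TTheory GRing.Theory Num.Theory.
Import numFieldNormedType.Exports.

Local Open Scope classical_set_scope.
Local Open Scope ring_scope.

Section lebesgue_volume.
Variables (R : realType) (d : nat).
Implicit Types (a b : 'rV[R]_d) (A : set 'rV[R]_d).

Definition box a b : set 'rV[R]_d :=
  [set x | forall i, a ord0 i <= x ord0 i <= b ord0 i].

(* The maximum gives volume 0 to a box that is empty because some b_i < a_i. *)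
Definition box_volume a b : R :=
  \prod_(i < d) Num.max 0 (b ord0 i - a ord0 i).

(* Lebesgue outer measure on R^d; its restriction to the Caratheodory
   measurable sets is Lebesgue measure. *)
Definition vol A : \bar R :=
  ereal_inf [set (\sum_(0 <= k <oo) (box_volume (c k).1 (c k).2)%:E)%E
            | c in [set c : nat -> 'rV[R]_d * 'rV[R]_d |
                     A `<=` \bigcup_k box (c k).1 (c k).2]].

(* "Measurable subset of R^d" is left open between Borel and Lebesgue
   measurable: M may be either sigma-algebra, or any one in between. *)
Definition euclidean_sigma_algebra (M : set (set 'rV[R]_d)) : Prop :=
  [/\ sigma_algebra setT M,
      <<s @open 'rV[R]_d >> `<=` M &
      M `<=` vol.-caratheodory].

End lebesgue_volume.

Section random_elements.
Local Open Scope ereal_scope.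
Context d (T : measurableType d) (R : realType) (P : probability T R).

Definition random_element (E : Type) (M : set (set E)) (X : T -> E) : Prop :=
  forall A, M A -> measurable (X @^-1` A).

(* Mutual independence of the family (X p)_(p in D): the product rule holds for
   every finite subfamily J of D. *)
Definition mutually_independent (I : choiceType) (D : set I) (E : Type)
    (M : set (set E)) (X : I -> T -> E) : Prop :=
  forall J : seq I, uniq J -> [set` J] `<=` D ->
  forall A : I -> set E, (forall p, M (A p)) ->
    P (\bigcap_(p in [set` J]) (X p @^-1` A p)) =
    \prod_(p <- J) P (X p @^-1` A p).

Definition uniform_over (n : nat) (M : set (set 'rV[R]_n)) (B : set 'rV[R]_n)
    (X : T -> 'rV[R]_n) : Prop :=
  forall A, M A ->
    P (X @^-1` A) = ((fine (vol B))^-1)%:E * vol (A `&` B).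

Definition poisson_variable (rate : R) (W : {RV P >-> nat}) : Prop :=
  forall k : nat, P [set w | W w = k] = (poisson_pmf rate k)%:E.

End random_elements.

(* Convergence in distribution of real random variables f n, each on its own
   probability space, to g: the distribution functions converge at every
   continuity point of the distribution function of g. *)
Definition cvg_in_distribution (R : realType)
    (d : nat -> measure_display) (T : forall n, measurableType (d n))
    (P : forall n, probability (T n) R) (f : forall n, T n -> R)
    (d' : measure_display) (T' : measurableType d') (Q : probability T' R)
    (g : T' -> R) : Prop :=
  forall x : R,
    {for x, continuous (fun y => Q [set w | g w <= y])} ->
    P n [set w | f n w <= x] @[n --> \oo] --> Q [set w | g w <= x].

Section sample_reuse.
Variable E : Type.

(* (Z_1, ..., Z_b; k) from (X_1, ..., X_a) and (Y_1, ..., Y_b), a <= b: the k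
   terms X_i lying in B, in their original order, followed by
   Y_(k+1), ..., Y_b. *)
Definition sample_reuse (B : set E) (X Y : seq E) : seq E * nat :=
  let Z := [seq x <- X | x \in B] in (Z ++ drop (size Z) Y, size Z).

Variables (B : nat -> set E) (X : nat -> seq E).

(* (Y_(l,1), ..., Y_(l,N)), where X l is (X_(l,1), ..., X_(l,N)).  Stages are
   numbered from 1; stage 0 is a dummy. *)
Fixpoint stage (l : nat) : seq E :=
  match l with
  | 0 => [::]
  | l'.+1 => if l' == 0 then X 1
             else (sample_reuse (B l) (stage l') (X l)).1
  end.

Definition reused (l : nat) : nat :=
  (sample_reuse (B l) (stage l.-1) (X l)).2.

End sample_reuse.

(* A nested family B_1, ..., B_m in R^n together with samples X_(l,i) as in the
   sample reuse algorithm.  B l and X l are only meaningful for 1 <= l <= m. *)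
Record reuse_scheme (R : realType) (N : nat) (Vmax Vmin : R) := ReuseScheme {
  rs_dim : nat ;
  rs_meas : set (set 'rV[R]_rs_dim) ;
  rs_m : nat ;
  rs_B : nat -> set 'rV[R]_rs_dim ;
  rs_disp : measure_display ;
  rs_T : measurableType rs_disp ;
  rs_P : probability rs_T R ;
  rs_X : nat -> 'I_N -> rs_T -> 'rV[R]_rs_dim ;
  rs_measP : euclidean_sigma_algebra rs_meas ;
  rs_m_ge2 : (2 <= rs_m)%N ;
  rs_B_measurable : forall l, (1 <= l <= rs_m)%N -> rs_meas (rs_B l) ;
  rs_B_nested : forall l, (1 <= l < rs_m)%N -> rs_B l.+1 `<=` rs_B l ;
  rs_B_first : vol (rs_B 1) = Vmax%:E ;
  rs_B_last : vol (rs_B rs_m) = Vmin%:E ;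
  rs_X_random : forall l i, (1 <= l <= rs_m)%N ->
    random_element rs_meas (rs_X l i) ;
  rs_X_uniform : forall l i, (1 <= l <= rs_m)%N ->
    uniform_over rs_P rs_meas (rs_B l) (rs_X l i) ;
  rs_X_independent :
    mutually_independent rs_P [set p : nat * 'I_N | (1 <= p.1 <= rs_m)%N]
      rs_meas (fun p => rs_X p.1 p.2)
}.

Section original_samples.
Variables (R : realType) (N : nat) (Vmax Vmin : R).
Variable F : reuse_scheme N Vmax Vmin.

Definition num_original (l : nat) (w : rs_T F) : nat :=
  (N - reused (rs_B (r:=F)) (fun j => [seq rs_X (r:=F) j i w | i <- enum 'I_N]) l)%N.

Definition total_original (w : rs_T F) : nat :=
  (\sum_(2 <= l < (rs_m F).+1) num_original l w)%N.

Definition max_volume_gap : R :=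
  \big[Num.max/0]_(2 <= l < (rs_m F).+1)
    (fine (vol (rs_B (r:=F) l.-1)) - fine (vol (rs_B (r:=F) l))).

End original_samples.

(* Main.v *)
Require Import Defs.
From HB Require Import structures.
From mathcomp Require Import all_boot all_order all_algebra.
From mathcomp Require Import all_classical all_reals all_analysis.
From mathcomp Require Import zify ring lra.

Import Order.TTheory GRing.Theory Num.Theory.
Import numFieldNormedType.Exports.
Local Open Scope classical_set_scope.
Local Open Scope ring_scope.

(** A sample retained by the filter [B_(l+1)] has the law of a fresh sample from
[B_(l+1)], so after each stage the [N] current samples are again independent and
uniform, and independent of the number of fresh samples drawn so far.  Hence the
total is a sum of independent Bernoulli variables, [N] of them with success
probability [1 - r_l] for each [l], where [r_l = vol B_(l+1) / vol B_l].

A Bernoulli variable of parameter [1 - r] is distributed as [min(Z, 1)] with [Z]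
Poisson of rate [- ln r]; these rates add up to [N ln (Vmax / Vmin)].
Replacing the Bernoulli variables by Poisson ones one at a time decreases each
distribution function, strictly except at [0] when [r < 1], and by at most
[(1 - r)^2]; the sum of these squares is bounded by a multiple of the largest
volume gap. *)

(** * Sums of independent Bernoulli variables and the Poisson law *)

Section poisson_cdf.
Context {R : realType}.
Implicit Types (x y r : R) (n k : nat) (G : nat -> R).

(* Unlike [poisson_pmf], whose value at a nonpositive rate is the junk value 1,
   this is the point mass at 0 for [x = 0]. *)
Definition pois x k : R := x ^+ k / k`!%:R * expR (- x).

(* P(Z < n), with a strict inequality, so that the value at [n = 0] is 0. *)
Definition pcdf x n : R := \sum_(j < n) pois x j.

Lemma pois0 x : pois x 0 = expR (- x).
Proof. by rewrite /pois expr0 fact0 divr1 mul1r. Qed.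

Lemma pois_ge0 x k : 0 <= x -> 0 <= pois x k.
Proof. by move=> x0; rewrite /pois mulr_ge0 ?expR_ge0 ?divr_ge0 ?exprn_ge0. Qed.

Lemma pois_gt0 x k : 0 < x -> 0 < pois x k.
Proof.
by move=> x0; rewrite /pois mulr_gt0 ?expR_gt0 ?divr_gt0 ?exprn_gt0.
Qed.

Lemma poisson_pmfE x k : 0 < x -> poisson_pmf x k = pois x k.
Proof. by move=> x0; rewrite /poisson_pmf x0. Qed.

Lemma pcdf0 x : pcdf x 0 = 0.
Proof. by rewrite /pcdf big_ord0. Qed.

Lemma pcdfS x n : pcdf x n.+1 = pcdf x n + pois x n.
Proof. by rewrite /pcdf big_ord_recr. Qed.

Lemma pcdf_le x n k : 0 <= x -> (n <= k)%N -> pcdf x n <= pcdf x k.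
Proof.
move=> x0 /subnK <-; elim: (k - n)%N => // i IH.
by rewrite addSn pcdfS (le_trans IH) // lerDl pois_ge0.
Qed.

Lemma pcdf_ge0 x n : 0 <= x -> 0 <= pcdf x n.
Proof. by move=> x0; rewrite -(pcdf0 x) pcdf_le. Qed.

Lemma pcdf_gt0 x n : 0 <= x -> (0 < n)%N -> 0 < pcdf x n.
Proof.
move=> x0 n0; rewrite (lt_le_trans _ (pcdf_le x 1 n x0 n0)) //.
by rewrite pcdfS pcdf0 add0r pois0 expR_gt0.
Qed.

Lemma pcdf_le1 x n : 0 <= x -> pcdf x n <= 1.
Proof.
move=> x0; rewrite /pcdf -mulr_suml expRN ler_pdivrMr ?expR_gt0 // mul1r.
rewrite -(big_mkord predT (exp_coeff x)).
apply: nondecreasing_cvgn_le (is_cvg_series_exp_coeff x) n.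
by apply/nondecreasing_seqP => k; rewrite seriesSr lerDl exp_coeff_ge0.
Qed.

Lemma pcdf_lt1 x n : 0 < x -> pcdf x n < 1.
Proof.
move=> x0; apply: lt_le_trans (pcdf_le1 x n.+1 (ltW x0)).
by rewrite pcdfS ltrDl pois_gt0.
Qed.

Lemma pcdf_rate0 n : pcdf 0 n = (0 < n)%N%:R.
Proof.
case: n => [|n]; first exact: pcdf0.
rewrite /pcdf big_ord_recl big1 => [|i _].
  by rewrite pois0 oppr0 expR0 addr0.
by rewrite /pois expr0n /= !mul0r.
Qed.

Lemma poisD x y n :
  pois (x + y) n = \sum_(j < n.+1) pois x j * pois y (n - j)%N.
Proof.
rewrite /pois addrC exprDn opprD expRD !mulr_suml; apply: eq_bigr => -[j] /=.
rewrite ltnS => jn _; rewrite -mulr_natr -(bin_fact jn) !natrM.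
have f0 k : k`!%:R != 0 :> R by rewrite pnatr_eq0 -lt0n fact_gt0.
have b0 : 'C(n, j)%:R != 0 :> R by rewrite pnatr_eq0 -lt0n bin_gt0.
by field; rewrite !f0 b0.
Qed.

(** Convolution: condition on the value [j] of the first of two independent Poisson variables. *)
Lemma pcdfD x y n :
  pcdf (x + y) n = \sum_(j < n) pois x j * pcdf y (n - j)%N.
Proof.
elim: n => [|n IH]; first by rewrite pcdf0 big_ord0.
rewrite pcdfS IH poisD.
(* The extra term [j = n] vanishes because [pcdf y 0 = 0]. *)
have -> : \sum_(j < n) pois x j * pcdf y (n - j)%N =
          \sum_(j < n.+1) pois x j * pcdf y (n - j)%N.
  by rewrite big_ord_recr /= subnn pcdf0 mulr0 addr0.
rewrite -big_split; apply: eq_bigr => -[j jn] _ /=.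
by rewrite subSn // pcdfS mulrDr.
Qed.

(* If [G n = P(Z < n)], then [bern r G n = P(Z + b < n)], where [b] is an
   independent Bernoulli variable with [P(b = 0) = r]; [G 0 = 0] makes the
   truncation [0.-1 = 0] harmless. *)
Definition bern r G n : R := r * G n + (1 - r) * G n.-1.

Lemma pcdfD_recl x y n : pcdf (x + y) n.+1 =
  expR (- x) * pcdf y n.+1 + \sum_(j < n) pois x j.+1 * pcdf y (n - j)%N.
Proof. by rewrite pcdfD big_ord_recl pois0 subn0. Qed.

Lemma pcdf_recl x n :
  \sum_(j < n) pois x j.+1 = pcdf x n.+1 - expR (- x).
Proof. by rewrite /pcdf big_ord_recl pois0 addrAC subrr add0r. Qed.

(** The sum is the contribution of the event where the first variable is positive; there the second
    one must stay below [n]. *)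
Lemma pcdfD_tail_le x y n : 0 <= x -> 0 <= y ->
  \sum_(j < n) pois x j.+1 * pcdf y (n - j)%N
  <= (pcdf x n.+1 - expR (- x)) * pcdf y n.
Proof.
move=> x0 y0; rewrite -pcdf_recl mulr_suml; apply: ler_sum => j _.
by rewrite ler_wpM2l ?pois_ge0 // pcdf_le // leq_subr.
Qed.

(** With [Z] Poisson of rate [x], the right-hand side replaces [Z] by the smaller variable
    [min(Z, 1)]. *)
Lemma pcdf_le_bern x y n : 0 <= x -> 0 <= y ->
  pcdf (x + y) n <= bern (expR (- x)) (pcdf y) n.
Proof.
move=> x0 y0; case: n => [|n]; first by rewrite /bern !pcdf0 !mulr0 addr0.
rewrite pcdfD_recl /bern lerD2l (le_trans (pcdfD_tail_le x y n x0 y0)) //.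
by rewrite ler_wpM2r ?pcdf_ge0 // lerD2r pcdf_le1.
Qed.

(** Strictness comes from arbitrarily large values of the variable of rate [x]: they have positive
    probability, and only truncation at 1 keeps the sum below [n]. *)
Lemma pcdf_lt_bern x y n : 0 < x -> 0 <= y -> (1 < n)%N ->
  pcdf (x + y) n < bern (expR (- x)) (pcdf y) n.
Proof.
move=> x0 y0; case: n => [|n] //; rewrite ltnS => n0.
rewrite pcdfD_recl /bern ltrD2l (le_lt_trans (pcdfD_tail_le x y n (ltW x0) y0)) //.
by rewrite ltr_pM2r ?pcdf_gt0 // ltrD2r pcdf_lt1.
Qed.

Lemma pcdf1_bern x y : pcdf (x + y) 1 = bern (expR (- x)) (pcdf y) 1.
Proof. by rewrite pcdfD_recl big_ord0 /bern pcdf0 mulr0. Qed.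

(** Truncation at 1 matters only when [Z >= 2]. With [u = expR (- x)] this has probability
    [1 - u - x * u], which is at most [(1 - u) ^+ 2] because [1 - x <= u]. *)
Lemma bern_le_pcdf x y n : 0 <= x -> 0 <= y ->
  bern (expR (- x)) (pcdf y) n <= pcdf (x + y) n + (1 - expR (- x)) ^+ 2.
Proof.
move=> x0 y0; case: n => [|[|n]].
- by rewrite /bern !pcdf0 !mulr0 !add0r sqr_ge0.
- by rewrite pcdf1_bern lerDl sqr_ge0.
have u1 : expR (- x) <= 1 by rewrite -expR0 ler_expR oppr_le0.
have u2 : 1 - x <= expR (- x) by exact: expR_ge1Dx.
rewrite pcdfD_recl /bern -addrA lerD2l big_ord_recl subn0.
rewrite /pois expr1 divr1 -/(pois _ _).
set S := \sum_(_ < _) _; set u := expR _ in u1 u2 *.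
have S0 : 0 <= S.
  by apply: sumr_ge0 => i _; rewrite mulr_ge0 ?pcdf_ge0 // pois_ge0.
have c0 : 0 <= pcdf y n.+1 by exact: pcdf_ge0.
have c1 : pcdf y n.+1 <= 1 by exact: pcdf_le1.
have u0 : 0 <= u by exact: expR_ge0.
have h : (1 - u - x * u) * pcdf y n.+1 <= (1 - u) ^+ 2 * pcdf y n.+1.
  by rewrite ler_wpM2r //; nra.
have h2 : (1 - u) ^+ 2 * pcdf y n.+1 <= (1 - u) ^+ 2.
  by rewrite ler_piMr ?sqr_ge0.
by rewrite /= in S0 h h2 c0 c1 *; lra.
Qed.

(** * Comparison for a whole list of Bernoulli variables *)

Lemma ler_bern r G G' n : 0 <= r <= 1 -> (forall k, G k <= G' k) ->
  bern r G n <= bern r G' n.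
Proof.
move=> /andP[r0 r1] GG'; rewrite /bern.
by apply: lerD; apply: ler_wpM2l; rewrite ?subr_ge0 ?GG'.
Qed.

(** P(S < n) for a sum S of independent Bernoulli variables, one for each [r], vanishing with
    probability [r]; the base case is the law of the constant 0. *)
Definition bern_cdf (rs : seq R) : nat -> R :=
  foldr bern (fun n => (0 < n)%N%:R) rs.

Definition log_rate (rs : seq R) : R := \sum_(r <- rs) - ln r.

Lemma log_rate_ge0 rs : all (fun r => 0 < r <= 1) rs -> 0 <= log_rate rs.
Proof.
move=> /allP h; rewrite /log_rate big_seq_cond; apply: sumr_ge0 => r.
by rewrite andbT => /h /andP[_ r1]; rewrite oppr_ge0 ln_le0.
Qed.

Lemma pcdf_le_bern_cdf rs n : all (fun r => 0 < r <= 1) rs ->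
  pcdf (log_rate rs) n <= bern_cdf rs n.
Proof.
elim: rs n => [|r rs IH] n /=; first by rewrite /log_rate big_nil pcdf_rate0.
move=> /andP[/andP[r0 r1] hrs]; rewrite /log_rate big_cons -/(log_rate rs).
rewrite (le_trans (pcdf_le_bern _ _ _ _ (log_rate_ge0 _ hrs))) ?oppr_ge0 ?ln_le0 //.
by rewrite opprK lnK ?posrE //; apply: ler_bern => [|k]; rewrite ?(ltW r0) ?r1 ?IH.
Qed.

Lemma bern_cdf0 rs : bern_cdf rs 0 = 0.
Proof. by elim: rs => //= r rs IH; rewrite /bern IH !mulr0 addr0. Qed.

Lemma bern_cdf1 rs : all (fun r => 0 < r <= 1) rs ->
  bern_cdf rs 1 = pcdf (log_rate rs) 1.
Proof.
elim: rs => [|r rs IH] /=; first by rewrite /log_rate big_nil pcdf_rate0.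
move=> /andP[/andP[r0 r1] hrs]; rewrite /log_rate big_cons -/(log_rate rs).
rewrite pcdf1_bern opprK lnK ?posrE // /bern IH // bern_cdf0.
by rewrite pcdf0.
Qed.

(** The first [r < 1] in the list gives the strict step; an entry equal to 1 has rate 0 and leaves
    both sides unchanged. *)
Lemma pcdf_lt_bern_cdf rs n : all (fun r => 0 < r <= 1) rs ->
  has (fun r => r < 1) rs -> (1 < n)%N ->
  pcdf (log_rate rs) n < bern_cdf rs n.
Proof.
elim: rs n => [//|r rs IH] n /= /andP[/andP[r0 r1] hrs].
rewrite /log_rate big_cons -/(log_rate rs).
move: (log_rate_ge0 _ hrs) => y0.
have [r1' _ n1|r1' /= hs n1] := ltP r 1.
  have x0 : 0 < - ln r by rewrite oppr_gt0 ln_lt0 ?r0.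
  apply: lt_le_trans (pcdf_lt_bern _ _ _ x0 y0 n1) _.
  rewrite opprK lnK ?posrE //.
  by apply: ler_bern => [|k]; rewrite ?r1 ?(ltW r0) ?pcdf_le_bern_cdf.
have {r1 r1'} -> : r = 1 by apply/le_anti; rewrite r1 r1'.
rewrite ln1 oppr0 add0r /bern subrr mul0r mul1r addr0.
exact: IH.
Qed.

(** The errors simply add up, since [bern r] is a convex combination and passes on an additive
    constant unchanged. *)
Lemma bern_cdf_le_pcdf rs n : all (fun r => 0 < r <= 1) rs ->
  bern_cdf rs n <= pcdf (log_rate rs) n + \sum_(r <- rs) (1 - r) ^+ 2.
Proof.
elim: rs n => [|r rs IH] n /=.
  by rewrite /log_rate !big_nil pcdf_rate0 addr0.
move=> /andP[/andP[r0 r1] hrs]; rewrite /log_rate !big_cons -/(log_rate rs).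
have := bern_le_pcdf (- ln r) _ n _ (log_rate_ge0 _ hrs).
rewrite opprK lnK ?posrE // oppr_ge0 ln_le0 // => /(_ isT).
have := ler_bern r (bern_cdf rs)
  (fun k => pcdf (log_rate rs) k + \sum_(s <- rs) (1 - s) ^+ 2) n.
rewrite r1 (ltW r0) => /(_ isT (fun k => IH k hrs)).
rewrite /bern; lra.
Qed.

End poisson_cdf.

(** * The recycling step on discrete samples *)

Section expectation.
Context {R : realType} (K : nat).
Implicit Types (q : nat -> R) (qs : seq (nat -> R)) (f g : seq nat -> R).

(** Expectation of [f] under the product of the mass functions [qs] on [{0, ..., K - 1}]; the
    recursion allows conditioning on the first coordinate. *)
Fixpoint expect qs f : R :=
  if qs is q :: qs' then \sum_(a < K) q a * expect qs' (fun s => f (val a :: s))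
  else f [::].

Lemma eq_expect qs f g :
  (forall s, size s = size qs -> f s = g s) -> expect qs f = expect qs g.
Proof.
elim: qs f g => [|q qs IH] f g fg /=; first exact: fg.
by apply: eq_bigr => a _; congr (_ * _); apply: IH => s ss; rewrite fg //= ss.
Qed.

Lemma expect_cat qs1 qs2 f : expect (qs1 ++ qs2) f =
  expect qs1 (fun s1 => expect qs2 (fun s2 => f (s1 ++ s2))).
Proof.
elim: qs1 f => [//|q qs IH] f /=.
by apply: eq_bigr => a _; rewrite IH.
Qed.

Lemma expect_cst n q x : \sum_(a < K) q a = 1 ->
  expect (nseq n q) (fun=> x) = x.
Proof.
move=> q1; elim: n => //= n ->.
by rewrite -mulr_suml q1 mul1r.
Qed.

Lemma iter_bern_sum n r (c : nat -> R) (G : nat -> nat -> R) b :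
  iter n (bern r) (fun b => \sum_(a < K) c a * G a b) b =
  \sum_(a < K) c a * iter n (bern r) (G a) b.
Proof.
elim: n b => [//|n IH] b; rewrite iterS /bern !IH !mulr_sumr -big_split.
by apply: eq_bigr => a _ /=; ring.
Qed.

(* Induction on [n]: a retained sample has law [q'] given that it is retained and
   takes the place of one fresh sample, so [N] drops by one; a rejected one
   lowers the budget [b] by one. *)
Lemma expect_recycle n N l q q' r (g : seq nat -> nat -> R) b :
  (forall a, (a < K)%N -> (l < a)%N -> q a = r * q' a) ->
  (forall a, (a <= l)%N -> q' a = 0) ->
  \sum_(a < K | (a <= l)%N) q a = 1 - r ->
  \sum_(a < K) q' a = 1 ->
  (n <= N)%N ->
  expect (nseq n q) (fun c => expect (nseq N q') (fun x =>
    let z := [seq a <- c | (l < a)%N] in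
    g (z ++ drop (size z) x) (b - (n - size z))%N)) =
  iter n (bern r) (fun b => expect (nseq N q') (g^~ b)) b.
Proof.
move=> qpass q'0 qfail q'1; elim: n N g b => [|n IH] N g b nN.
  by rewrite /=; apply: eq_expect => x _; rewrite drop0 !subn0.
rewrite iterS [expect (nseq n.+1 q) _]/= (bigID (fun a : 'I_K => (l < a)%N)) /=.
rewrite {1}/bern; congr (_ + _).
  case: N nN => [//|N]; rewrite ltnS => nN.
  have -> : (fun b0 => expect (nseq N.+1 q') (g^~ b0)) = (fun b0 =>
    \sum_(a < K) q' a * expect (nseq N q') (fun s => g (val a :: s) b0)) by [].
  rewrite (iter_bern_sum n r q'
    (fun a b0 => expect (nseq N q') (fun s => g (a :: s) b0))).
  rewrite [in RHS](bigID (fun a : 'I_K => (l < a)%N)) /=.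
  rewrite [X in _ = r * (_ + X)]big1 ?addr0; last first.
    by move=> a; rewrite -leqNgt => al; rewrite q'0 // mul0r.
  rewrite mulr_sumr; apply: eq_bigr => a la; rewrite mulrA -qpass //.
  congr (_ * _); rewrite -(IH N (fun y => g (val a :: y))) //.
  apply: eq_expect => c _; rewrite la /=.
  (* The retained sample displaces one fresh sample, on which the integrand no longer depends; its
     mass sums to 1. *)
  by rewrite /= -mulr_suml q'1 mul1r.
rewrite -qfail mulr_suml; apply: eq_big => [a|a]; rewrite -leqNgt // => al.
congr (_ * _); rewrite -(IH N g b.-1) ?(ltnW nN) //.
apply: eq_expect => c sc; apply: eq_expect => x _.
rewrite ltnNge al /=; congr g.
(* This bound makes the truncated difference [n.+1 - size z] the successor of [n - size z]. *)
have zn : (size [seq a <- c | (l < a)%N] <= n)%N.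
  by rewrite size_filter -[X in (_ <= X)%N](size_nseq n q) -sc count_size.
by rewrite subSn // -subn1 -subnDA add1n.
Qed.

(* Number of fresh samples used in the [m] stages after stage [l], when the
   samples are replaced by their depths (the last level containing them); [c]
   lists those of stage [l] and [fl] those of all later stages, [N] by [N]. *)
Fixpoint run (N m l : nat) (c fl : seq nat) : nat :=
  if m is m'.+1 then
    let z := [seq a <- c | (l < a)%N] in
    (N - size z + run N m' l.+1 (z ++ drop (size z) (take N fl)) (drop N fl))%N
  else 0%N.

Lemma runS N m l c fl : run N m.+1 l c fl =
  let z := [seq a <- c | (l < a)%N] in
  (N - size z + run N m l.+1 (z ++ drop (size z) (take N fl)) (drop N fl))%N.
Proof. by []. Qed.

(** True also for [b <= a], where both sides are false; hence a stage can be charged to the budget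
    [b] by truncated subtraction. *)
Lemma ltn_addl_sub (a t b : nat) : (a + t < b)%N = (t < b - a)%N.
Proof. lia. Qed.

(** By [expect_recycle], a stage turns samples of law [Q l] into samples of law [Q l.+1] at the
    price of [N] Bernoulli steps, so induction on the number of stages applies. *)
Lemma expect_run N (Q : nat -> nat -> R) (rho : nat -> R) m l b :
  (forall j, (l <= j <= l + m)%N -> \sum_(a < K) Q j a = 1) ->
  (forall j a, (l <= j < l + m)%N -> (a < K)%N -> (j < a)%N ->
     Q j a = rho j * Q j.+1 a) ->
  (forall j a, (l <= j < l + m)%N -> (a <= j)%N -> Q j.+1 a = 0) ->
  (forall j, (l <= j < l + m)%N -> \sum_(a < K | (a <= j)%N) Q j a = 1 - rho j) ->
  expect (nseq N (Q l)) (fun c =>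
    expect (flatten [seq nseq N (Q j) | j <- iota l.+1 m]) (fun fl =>
      (run N m l c fl < b)%N%:R)) =
  bern_cdf (flatten [seq nseq N (rho j) | j <- iota l m]) b.
Proof.
elim: m l b => [|m IH] l b Q1 Qpass Q0 Qfail.
  by rewrite /= expect_cst // Q1 // addn0 leqnn.
have hl : (l <= l < l + m.+1)%N by lia.
(* The probability that the later stages, started from [y], use fewer than [b] fresh samples. *)
pose g y b := expect (flatten [seq nseq N (Q j) | j <- iota l.+2 m])
  (fun fl => (run N m l.+1 y fl < b)%N%:R).
transitivity (iter N (bern (rho l)) (fun b => expect (nseq N (Q l.+1)) (g^~ b)) b).
  rewrite -(@expect_recycle N N l (Q l)) //.
  - apply: eq_expect => c _; rewrite /= expect_cat.
    apply: eq_expect => x; rewrite size_nseq => sx; apply: eq_expect => fl _.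
    by rewrite ltn_addl_sub take_size_cat // drop_size_cat.
  - by move=> a aK la; exact: Qpass.
  - by move=> a la; exact: Q0.
  - exact: Qfail.
  - by apply: Q1; lia.
rewrite /bern_cdf /= foldr_cat.
have -> : (fun b => expect (nseq N (Q l.+1)) (g^~ b)) =
    bern_cdf (flatten [seq nseq N (rho j) | j <- iota l.+1 m]).
  apply/funext => b'; apply: IH => *; by [apply: Q1; lia | apply: Qpass; lia |
    apply: Q0; lia | apply: Qfail; lia].
have foldr_nseq n r G : foldr bern G (nseq n r) = iter n (bern r) G.
  by elim: n => //= n ->.
by rewrite foldr_nseq.
Qed.

End expectation.

(** Only the pieces of [A] on the fibres of [g] are assumed measurable; [A] is their finite disjoint
    union. *)
Lemma measure_split_nat {R : realType} {d : measure_display}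
    {T : measurableType d} (P : probability T R) (K : nat) (g : T -> nat)
    (A : set T) :
  (forall w, A w -> (g w < K)%N) ->
  (forall a, (a < K)%N -> measurable (A `&` [set w | g w = a])) ->
  measurable A /\ P A = (\sum_(a < K) P (A `&` [set w | g w = val a]))%E.
Proof.
move=> gK mA.
pose F (a : nat) := A `&` [set w | g w = a].
have AE : A = \big[setU/set0]_(a < K) F a.
  rewrite -bigcup_mkord; apply/seteqP; split=> w; last by case=> ? _ [].
  by move=> Aw; exists (g w) => //=; exact: gK.
have mA' : measurable A.
  by rewrite AE; apply: bigsetU_measurable => a _; exact: mA.
split=> //; rewrite [in LHS]AE measure_semi_additive_ord //.
- by move=> a; exact: mA.
- move=> i j _ _ [w [[_ /= wi] [_ /= wj]]].
  by apply: val_inj; rewrite /= -wi -wj.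
- by rewrite -AE.
Qed.

(** * Joint law of a finite-valued function of independent random elements *)

Section product_law.
Local Open Scope ereal_scope.
Context {R : realType} {d : measure_display} {T : measurableType d}.
Context (P : probability T R) {I : choiceType} (D : set I) {E : Type}.
Context (M : set (set E)) (X : I -> T -> E) (K : nat) (f : E -> nat).
Hypothesis fK : forall x, (f x < K)%N.
Hypothesis Mf : forall a, M [set x | f x = a].
Hypothesis mX : forall p, D p -> random_element M (X p).
Hypothesis indX : mutually_independent P D M X.

Definition law p (a : nat) : R := fine (P (X p @^-1` [set x | f x = a])).

Lemma lawE p a : D p -> (law p a)%:E = P (X p @^-1` [set x | f x = a]).
Proof. by move=> Dp; rewrite fineK // fin_num_measure //; exact: mX. Qed.

Lemma sum_law p : D p -> (\sum_(a < K) law p a = 1)%R.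
Proof.
move=> Dp; apply: EFin_inj; rewrite -sumEFin.
have [_ PT] := @measure_split_nat R d T P K (f \o X p) setT (fun w _ => fK _)
  (fun a _ => eq_ind_r measurable (mX p Dp _ (Mf a)) (setTI _)).
rewrite -(@probability_setT _ _ _ P) PT; apply: eq_bigr => a _.
by rewrite lawE // setTI.
Qed.

Definition cylinder (J : seq I) (A : I -> set E) : set T :=
  \bigcap_(p in [set` J]) (X p @^-1` A p).

Lemma measurable_cylinder J A : [set` J] `<=` D -> (forall p, M (A p)) ->
  measurable (cylinder J A).
Proof.
move=> JD MA; apply: fin_bigcap_measurable; first exact: finite_seq.
by move=> p /JD Dp; exact: mX.
Qed.

(** The cylinder over [J1] is there for the induction: splitting on the value of [f] at the head of
    [J2] moves that index into the cylinder, where independence applies. *)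
Lemma expect_law J1 J2 A (S : pred (seq nat)) :
  uniq (J1 ++ J2) -> [set` J1 ++ J2] `<=` D -> (forall p, M (A p)) ->
  let C := cylinder J1 A `&` [set w | S [seq f (X p w) | p <- J2]] in
  measurable C /\ P C = P (cylinder J1 A) *
    (expect K [seq law p | p <- J2] (fun s => (S s)%:R))%:E.
Proof.
elim: J2 J1 A S => [|p J2 IH] J1 A S uJ JD MA /=.
  rewrite cats0 in uJ JD; case: (S [::]).
    have -> : [set _ : T | true] = setT by apply/seteqP; split.
    by rewrite setIT mule1; split=> //; exact: measurable_cylinder.
  have -> : [set _ : T | false] = set0 by apply/seteqP; split.
  by rewrite setI0 measure0 mule0; split.
have uJ' : uniq ((p :: J1) ++ J2) by rewrite -cat1s -catA uniq_catCA.
have JD' : [set` (p :: J1) ++ J2] `<=` D.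
  by move=> i /= iJ; apply: JD; move: iJ; rewrite /= !(mem_cat, inE) orbCA.
have Dp : D p by apply: JD'; rewrite /= inE eqxx.
have pJ1 : p \notin J1.
  by move: uJ' => /= /andP[]; rewrite mem_cat negb_or => /andP[].
pose A' (a : nat) := fun i => if i == p then [set x | f x = a] else A i.
have MA' a i : M (A' a i) by rewrite /A'; case: ifP.
have splitE (a : nat) : (cylinder J1 A `&` [set w | S (f (X p w) :: [seq f (X p w) | p <- J2])]) `&`
     [set w | f (X p w) = a] =
   cylinder (p :: J1) (A' a) `&` [set w | S (a :: [seq f (X p w) | p <- J2])].
  apply/seteqP; split=> w /=.
    move=> [[cw Sw] fw]; split; last by rewrite -fw.
    move=> i /=; rewrite inE /A'; case: eqP => [->|_] //= iJ; exact: cw.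
  move=> [cw Sw].
  have fw : f (X p w) = a by have := cw p; rewrite /A' /= inE eqxx; apply.
  split=> //; split; last by rewrite fw.
  move=> i /= iJ; have := cw i; rewrite /= inE /A' iJ orbT => /(_ isT).
  by case: eqP => // ip; rewrite ip (negbTE pJ1) in iJ.
have J1D : [set` J1] `<=` D by move=> i /= iJ; apply: JD; rewrite /= mem_cat iJ.
have uJ1 : uniq J1 by move: uJ; rewrite cat_uniq => /andP[].
have cylE (a : nat) : P (cylinder (p :: J1) (A' a)) = P (cylinder J1 A) * (law p a)%:E.
  rewrite /cylinder !indX //=; last 2 first.
  - by rewrite pJ1.
  - by move=> i; rewrite /= inE => /predU1P[->//|/J1D].
  rewrite big_cons {1}/A' eqxx lawE // muleC; congr (_ * _).
  rewrite big_seq [RHS]big_seq; apply: eq_bigr => i iJ; rewrite /A'.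
  by case: eqP => // ip; rewrite ip (negbTE pJ1) in iJ.
set C := _ `&` _.
have [||mC ->] := @measure_split_nat R d T P K (f \o X p) C.
- by move=> w _; exact: fK.
- move=> a _; rewrite /C splitE; exact: (IH _ _ (fun s => S (a :: s)) uJ' JD' (MA' a)).1.
split=> //.
have cfin : P (cylinder J1 A) \is a fin_num.
  by apply: fin_num_measure; exact: measurable_cylinder.
rewrite -(fineK cfin) -EFinM mulr_sumr -sumEFin; apply: eq_bigr => a _.
have [_ ] := IH _ _ (fun s => S (val a :: s)) uJ' JD' (MA' a).
by rewrite /C splitE => ->; rewrite cylE -(fineK cfin) -!EFinM mulrA.
Qed.

End product_law.

(** * The law of the total number of original samples *)

Lemma subset_vol (R : realType) (n : nat) (A B : set 'rV[R]_n) :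
  A `<=` B -> (vol A <= vol B)%E.
Proof.
move=> AB; apply: ereal_inf_le_tmp => _ [c Bc <-].
by exists c => //; exact: subset_trans Bc.
Qed.

Section scheme.
Context {R : realType} {N : nat} {Vmax Vmin : R}.
Variable F : reuse_scheme N Vmax Vmin.
Hypothesis hN : (1 <= N)%N.
Hypothesis hVmin : 0 < Vmin.

Local Notation m := (rs_m F).
Local Notation B := (rs_B (r := F)).
Local Notation M := (rs_meas (r := F)).
Local Notation P := (rs_P F).

(** By nestedness the levels containing [x] form an initial segment, so this count is the index of
    the last one, and 0 outside the first. *)
Definition depth (x : 'rV[R]_(rs_dim F)) : nat :=
  count (fun j => x \in B j) (iota 1 m).

Definition volume (l : nat) : R := fine (vol (B l)).

Lemma subset_levels i j : (1 <= i <= j)%N -> (j <= m)%N -> B j `<=` B i.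
Proof.
move=> /andP[i1 ij]; rewrite -(subnK ij); elim: (j - i)%N => [_|k IH km]; first by move=> x.
have h : (1 <= k + i < m)%N by lia.
exact: subset_trans (rs_B_nested h) (IH (ltnW km)).
Qed.

Lemma depth_lt x : (depth x < m.+1)%N.
Proof. by rewrite ltnS (leq_trans (count_size _ _)) // size_iota. Qed.

Lemma leq_depth j x : (1 <= j <= m)%N -> (j <= depth x)%N = (x \in B j).
Proof.
move=> /andP[j1 jm].
have jE : m = (j.-1 + (m - j).+1)%N by lia.
rewrite /depth [X in iota 1 X]jE iotaD count_cat add1n prednK //.
(* If [x] lies in [B j], all levels up to [j] count; otherwise none from [j] on does. *)
have [xB|xB] := boolP (x \in B j).
  rewrite (eq_in_count (a2 := predT)) => [|i].
    rewrite count_predT size_iota /= xB; lia.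
  rewrite mem_iota => ij; apply/mem_set/(subset_levels i j); [lia|lia|].
  exact: set_mem.
rewrite [X in (_ + X)%N](eq_in_count (a2 := pred0)) => [|i].
  rewrite count_pred0 addn0; apply/negbTE; rewrite -ltnNge.
  by rewrite (leq_ltn_trans (count_size _ _)) // size_iota; lia.
rewrite mem_iota => ij; apply/negbTE; apply: contra xB => /set_mem xi.
apply/mem_set/(subset_levels j i) => //; lia.
Qed.

Lemma meas_depth_ge j : M [set x | (j <= depth x)%N].
Proof.
have [[M0 MC _] _ _] := rs_measP F.
have [->|j0] := posnP j.
  rewrite (_ : [set x | _] = setT `\` set0); first exact: MC.
  by rewrite setD0; apply/seteqP; split.
have [jm|mj] := leqP j m.
  rewrite (_ : [set x | _] = B j); first by apply: rs_B_measurable; rewrite j0.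
  apply/seteqP; split=> x /=; rewrite leq_depth ?j0 //.
    exact: set_mem.
  exact: mem_set.
rewrite (_ : [set x | _] = set0) //; apply/seteqP; split=> x //=.
by have := depth_lt x; lia.
Qed.

Lemma meas_depth a : M [set x | depth x = a].
Proof.
have /(sigma_algebraP (fun _ _ _ _ => I)) [_ MD _ _] : sigma_algebra setT M.
  by have [] := rs_measP F.
rewrite (_ : [set x | _] =
    [set x | (a <= depth x)%N] `\` [set x | (a < depth x)%N]).
  by apply: MD; [move=> x; exact: ltnW | exact: meas_depth_ge ..].
apply/seteqP; split=> x /=; first by move=> ->; split; lia.
by case=> ? /negP; lia.
Qed.

Lemma volume_bounds l : (1 <= l <= m)%N ->
  [/\ (volume l)%:E = vol (B l), Vmin <= volume l & volume l <= Vmax].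
Proof.
move=> /andP[l1 lm]; have m2 := rs_m_ge2 F.
have lo : (Vmin%:E <= vol (B l))%E.
  by rewrite -(rs_B_last F); apply: subset_vol; apply: subset_levels; lia.
have hi : (vol (B l) <= Vmax%:E)%E.
  by rewrite -(rs_B_first F); apply: subset_vol; apply: subset_levels; lia.
have fl : vol (B l) \is a fin_num.
  by rewrite fin_numElt (lt_le_trans _ lo) ?ltNyr //= (le_lt_trans hi) ?ltry.
by rewrite -!lee_fin /volume fineK.
Qed.

Lemma volume_gt0 l : (1 <= l <= m)%N -> 0 < volume l.
Proof. by move=> /volume_bounds[_ lo _]; exact: lt_le_trans lo. Qed.

Lemma volume_first : volume 1 = Vmax.
Proof. by rewrite /volume (rs_B_first F). Qed.

Lemma volume_last : volume m = Vmin.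
Proof. by rewrite /volume (rs_B_last F). Qed.

Lemma volume_le l : (1 <= l < m)%N -> volume l.+1 <= volume l.
Proof.
move=> lm; rewrite -lee_fin.
have [|-> _ _] := volume_bounds l; first lia.
have [|-> _ _] := volume_bounds l.+1; first lia.
exact/subset_vol/rs_B_nested.
Qed.

(** Read off from the uniform law of a sample at the empty event. The formula for [vol] alone would
    not do: in dimension 0 every box has volume 1, and it gives infinity. *)
Lemma vol_set0 : vol (set0 : set 'rV[R]_(rs_dim F)) = 0%E.
Proof.
have m2 := rs_m_ge2 F.
have l1 : (1 <= 1 <= m)%N by lia.
have [[M0 _ _] _ _] := rs_measP F.
have := rs_X_uniform (Ordinal hN) l1 M0.
rewrite preimage_set0 measure0 set0I => /esym/eqP.
rewrite mule_eq0 eqe invr_eq0 => /orP[|/eqP //].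
by rewrite (gt_eqF (volume_gt0 1 l1)).
Qed.

(** * Law of the depth of a uniform sample *)

Local Notation X := (fun p : nat * 'I_N => rs_X (r := F) p.1 p.2).
Local Notation D := [set p : nat * 'I_N | (1 <= p.1 <= m)%N].

(** Index 0, available by [hN], represents all samples of level [l]; see [law_depth_eq]. *)
Definition depth_law (l : nat) : nat -> R :=
  law P X depth (l, Ordinal hN).

Lemma law_depthE l i a : (1 <= l <= m)%N -> law P X depth (l, i) a =
  (volume l)^-1 * fine (vol ([set x | depth x = a] `&` B l)).
Proof.
move=> lm; rewrite /law /= (rs_X_uniform i lm (meas_depth a)).
have [vE _ _] := volume_bounds l lm.
rewrite -/(volume l) fineM // fin_numElt.
rewrite (le_lt_trans (subset_vol _ _ _ _ (@subIsetr _ _ _))) -?vE ?ltry // andbT.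
rewrite (lt_le_trans _ (subset_vol _ _ _ _ (@sub0set _ _))) // vol_set0.
exact: ltNy0.
Qed.

Lemma law_depth_eq l i : (1 <= l <= m)%N -> law P X depth (l, i) = depth_law l.
Proof. by move=> lm; apply/funext => a; rewrite /depth_law !law_depthE. Qed.

Lemma sum_depth_law l : (1 <= l <= m)%N -> \sum_(a < m.+1) depth_law l a = 1.
Proof.
move=> lm; apply: (@sum_law _ _ _ P _ D _ M X m.+1 depth depth_lt meas_depth) => //.
by move=> p; exact: rs_X_random.
Qed.

Definition ratio (l : nat) : R := volume l.+1 / volume l.

(** Points of depth [a > l] lie in both levels, so the two laws differ only in the normalizing
    volume. *)
Lemma depth_law_pass l a : (1 <= l < m)%N -> (a < m.+1)%N -> (l < a)%N ->
  depth_law l a = ratio l * depth_law l.+1 a.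
Proof.
move=> lm am la; rewrite /depth_law !law_depthE; try lia.
have v0 : volume l != 0 by rewrite gt_eqF // volume_gt0 //; lia.
have v1 : volume l.+1 != 0 by rewrite gt_eqF // volume_gt0 //; lia.
have dE j : (1 <= j <= a)%N ->
    [set x | depth x = a] `&` B j = [set x | depth x = a].
  move=> ja; apply/setIidl => x /= xa; apply/set_mem.
  by rewrite -leq_depth; lia.
rewrite !dE; try lia.
by rewrite /ratio; field; rewrite ?v0 ?v1.
Qed.

Lemma depth_law_eq0 l a : (1 <= l < m)%N -> (a <= l)%N -> depth_law l.+1 a = 0.
Proof.
move=> lm al; rewrite /depth_law law_depthE; try lia.
rewrite (_ : _ `&` _ = set0) ?vol_set0 ?mulr0 //.
apply/seteqP; split=> // x [/= xa /mem_set]; rewrite -leq_depth; lia.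
Qed.

(** The complementary mass is [ratio l] times the total mass of [depth_law l.+1], which is 1. *)
Lemma depth_law_fail l : (1 <= l < m)%N ->
  \sum_(a < m.+1 | (a <= l)%N) depth_law l a = 1 - ratio l.
Proof.
move=> lm; have h1 : (1 <= l <= m)%N by lia.
have h2 : (1 <= l.+1 <= m)%N by lia.
have := sum_depth_law l h1; have := sum_depth_law l.+1 h2.
rewrite (bigID (fun a : 'I_m.+1 => (a <= l)%N)) /=.
rewrite [X in X + _]big1 => [|a al]; last exact: depth_law_eq0.
rewrite add0r => s1; rewrite (bigID (fun a : 'I_m.+1 => (a <= l)%N)) /= => <-.
rewrite -[ratio l]mulr1 -s1 mulr_sumr -addrA -[LHS]addr0; congr (_ + _).
apply/esym/eqP; rewrite subr_eq0; apply/eqP/eq_bigr => a; rewrite -ltnNge => la.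
exact: depth_law_pass.
Qed.

(** * Reduction of the algorithm to depths *)

Definition sample_row l w := [seq rs_X (r := F) l i w | i <- enum 'I_N].

(** Membership in [B l.+1] means depth greater than [l], so taking depths commutes with each
    recycling step. *)
Lemma run_depth k l w : (1 <= l)%N -> (l + k <= m)%N ->
  run N k l (map depth (stage B (fun j => sample_row j w) l))
    (flatten [seq map depth (sample_row j w) | j <- iota l.+1 k]) =
  (\sum_(l.+1 <= j < (l + k).+1) num_original j w)%N.
Proof.
elim: k l => [|k IH] l l1 lk; first by rewrite addn0 big_geq.
rewrite big_ltn; last lia.
rewrite runS [flatten _]/=.
have szrow : size (map depth (sample_row l.+1 w)) = N.
  by rewrite /sample_row 2!size_map size_enum_ord.
rewrite take_size_cat // drop_size_cat //.
have zE : [seq a <- map depth (stage B (fun j => sample_row j w) l) | (l < a)%N] =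
    map depth [seq x <- stage B (fun j => sample_row j w) l | x \in B l.+1].
  rewrite filter_map; congr map; apply: eq_filter => x /=.
  by rewrite leq_depth //; lia.
rewrite zE /= size_map -map_drop -map_cat addnS -addSn -IH; try lia.
congr (_ + run _ _ _ _ _)%N.
(* [l >= 1] selects the recursive branch of [stage] at [l.+1]. *)
congr map => /=; by case: l l1 {IH lk szrow zE}.
Qed.

Lemma total_original_run w : total_original w =
  run N m.-1 1 (map depth (sample_row 1 w))
    (flatten [seq map depth (sample_row j w) | j <- iota 2 m.-1]).
Proof.
have m2 := rs_m_ge2 F; rewrite /total_original.
rewrite -[map depth (sample_row 1 w)]/(map depth (stage B (fun j => sample_row j w) 1)).
rewrite run_depth; try lia.
by congr (\sum_(2 <= _ < _) _)%N; lia.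
Qed.

Definition ratios : seq R := flatten [seq nseq N (ratio j) | j <- iota 1 m.-1].

(** The total depends on the samples only through their depths: [expect_law] turns the probability
    into a finite expectation, which [expect_run] evaluates. *)
Lemma total_original_cdf b :
  P [set w | (total_original w < b)%N] = (bern_cdf ratios b)%:E.
Proof.
have m2 := rs_m_ge2 F.
(* Listing the indices level by level makes the first [N] depths those of stage 1, as [S]
   expects. *)
pose J := [seq (l, i) | l <- iota 1 m, i <- enum 'I_N].
pose S (s : seq nat) := (run N m.-1 1 (take N s) (drop N s) < b)%N.
have J_D : [set` J] `<=` D.
  move=> p /= /allpairsP[[l i] /= [+ _ ->]]; rewrite mem_iota /=; lia.
have uJ : uniq J.
  by apply: allpairs_uniq; rewrite ?iota_uniq ?enum_uniq // => -[? ?] [? ?].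
have mapJ (A : Type) (h : nat * 'I_N -> A) : [seq h p | p <- J] =
    [seq h (1%N, i) | i <- enum 'I_N] ++
    flatten [seq [seq h (l, i) | i <- enum 'I_N] | l <- iota 2 m.-1].
  have iE : iota 1 m = 1%N :: iota 2 m.-1 by case: (m) m2.
  rewrite /J iE /= map_cat -map_comp map_flatten -map_comp.
  by congr (_ ++ flatten _); apply: eq_map => l /=; rewrite -map_comp.
have [] := @expect_law _ _ _ P _ D _ M X m.+1 depth depth_lt meas_depth
  (fun p => @rs_X_random _ _ _ _ F p.1 p.2) (@rs_X_independent _ _ _ _ F)
  [::] J (fun=> setT) S uJ J_D.
  by move=> _; have [[M0 MC _] _ _] := rs_measP F; have := MC _ M0; rewrite setD0.
move=> _; rewrite /cylinder set_nil bigcap_set0 !setTI probability_setT mul1e.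
have -> : [set w | S [seq depth (X p w) | p <- J]] =
    [set w | (total_original w < b)%N].
  apply/seteqP; split => w /=; rewrite /S total_original_run;
  (suff -> : [seq depth (rs_X (r := F) p.1 p.2 w) | p <- J] =
    map depth (sample_row 1 w) ++ flatten [seq map depth (sample_row j w) | j <- iota 2 m.-1] by
    rewrite take_size_cat ?drop_size_cat // /sample_row 2!size_map size_enum_ord);
  rewrite mapJ /sample_row -map_comp; congr (_ ++ flatten _);
  by apply: eq_map => l; rewrite -map_comp.
move=> ->; congr (_%:E).
rewrite -(@expect_run R m.+1 N depth_law) //.
- have -> : [seq law P X depth p | p <- J] =
     nseq N (depth_law 1) ++ flatten [seq nseq N (depth_law j) | j <- iota 2 m.-1].
    have lawl l : (1 <= l <= m)%N ->
        [seq law P X depth (l, i) | i <- enum 'I_N] = nseq N (depth_law l).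
      move=> lm; rewrite -[in RHS](size_enum_ord N).
      by elim: (enum _) => //= i s ->; rewrite law_depth_eq.
    rewrite mapJ lawl; last lia; congr (_ ++ flatten _).
    by apply/eq_in_map => l; rewrite mem_iota => lm; apply: lawl; lia.
  rewrite expect_cat; apply: eq_expect => c; rewrite size_nseq => sc.
  by apply: eq_expect => fl _; rewrite /S take_size_cat ?drop_size_cat.
- by move=> j jm; apply: sum_depth_law; lia.
- by move=> j a jm; apply: depth_law_pass; lia.
- by move=> j a jm; apply: depth_law_eq0; lia.
- by move=> j jm; apply: depth_law_fail; lia.
Qed.

(** * Total rate and total squared error of the volume ratios *)

Lemma sum_ratios (f : R -> R) :
  \sum_(r <- ratios) f r = \sum_(1 <= j < m) f (ratio j) *+ N.
Proof.
have m2 := rs_m_ge2 F.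
rewrite /ratios big_flatten big_map /index_iota subn1; apply: eq_bigr => j _.
by rewrite big_nseq iter_addr_0.
Qed.

Lemma ratios_bounds : all (fun r => 0 < r <= 1) ratios.
Proof.
apply/allP => r /flattenP[s /mapP[j]]; rewrite mem_iota => jm -> /nseqP[-> _].
rewrite /ratio divr_gt0 ?volume_gt0 ?ler_pdivrMr ?volume_gt0 ?mul1r ?volume_le //; lia.
Qed.

Lemma log_rate_ratios : log_rate ratios = N%:R * ln (Vmax / Vmin).
Proof.
have m2 := rs_m_ge2 F.
have Vmax0 : 0 < Vmax by rewrite -volume_first volume_gt0; lia.
rewrite /log_rate sum_ratios sumrMnl mulr_natl; congr (_ *+ _).
rewrite (eq_big_nat _ _ (F2 := fun j => - ln (volume j.+1) - - ln (volume j))).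
  rewrite telescope_sumr ?volume_first ?volume_last; last lia.
  by rewrite ln_div ?posrE // opprK addrC.
move=> j jm; rewrite /ratio ln_div ?posrE ?volume_gt0; try lia.
by rewrite opprB opprK addrC.
Qed.

(** If all ratios were 1, the total rate [N%:R * ln (Vmax / Vmin)] would be 0. *)
Lemma ratios_lt1 : Vmin < Vmax -> has (fun r => r < 1) ratios.
Proof.
move=> hV; apply: contraT => /hasPn r1.
have : 0 < log_rate ratios.
  by rewrite log_rate_ratios mulr_gt0 ?ltr0n // ln_gt0 // ltr_pdivlMr // mul1r.
rewrite /log_rate big1_seq ?ltxx // => r /= rr.
have := r1 _ rr; have /allP/(_ _ rr)/andP[_] := ratios_bounds.
by rewrite -leNgt => a b; rewrite (_ : r = 1) ?ln1 ?oppr0 //; apply/le_anti; rewrite a.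
Qed.

(** Each [1 - ratio j] is at most the volume drop over [Vmin]. In the square, one drop is bounded by
    the largest gap, and the other telescopes to [Vmax - Vmin]. *)
Lemma sum_sqr_ratios : \sum_(r <- ratios) (1 - r) ^+ 2 <=
  max_volume_gap F * (N%:R * (Vmax - Vmin) / Vmin ^+ 2).
Proof.
have m2 := rs_m_ge2 F.
have -> : max_volume_gap F * (N%:R * (Vmax - Vmin) / Vmin ^+ 2) =
   (\sum_(1 <= j < m) max_volume_gap F / Vmin ^+ 2 * (- volume j.+1 - - volume j)) *+ N.
  rewrite -mulr_sumr telescope_sumr ?volume_first ?volume_last; last lia.
  by rewrite -mulr_natl; field; rewrite gt_eqF.
rewrite sum_ratios sumrMnl lerMn2r; apply/orP; right.
apply: ler_sum_nat => j jm.
have v0 : 0 < volume j by apply: volume_gt0; lia.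
have [_ vmin _] := volume_bounds j ltac:(lia).
have dj : 0 <= volume j - volume j.+1 by rewrite subr_ge0 volume_le //; lia.
have gap : volume j - volume j.+1 <= max_volume_gap F.
  rewrite /max_volume_gap.
  apply: (le_bigmax_seq _ j.+1 (fun=> true)
    (fun l => fine (vol (B l.-1)) - fine (vol (B l)))) => //.
  by rewrite mem_index_iota; lia.
have h : 1 - ratio j <= (volume j - volume j.+1) / Vmin.
  rewrite /ratio -[X in X - _](divff (lt0r_neq0 v0)) -mulrBl.
  by rewrite ler_wpM2l // lef_pV2 ?posrE.
have h0 : 0 <= 1 - ratio j.
  by rewrite subr_ge0 ler_pdivrMr // mul1r -subr_ge0.
apply: le_trans (ler_pM h0 h0 h h) _; rewrite opprK [- _ + _]addrC.
rewrite mulrACA -invfM -(expr2 Vmin) [leRHS]mulrAC ler_wpM2r ?invr_ge0 ?sqr_ge0 //.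
by rewrite ler_wpM2r.
Qed.

End scheme.

(** * Comparison with the given Poisson variable *)

Lemma poisson_variable_cdf (R : realType) (d : measure_display)
    (T : measurableType d) (Q : probability T R) (W : {RV Q >-> nat})
    (x : R) (k : nat) : 0 < x -> poisson_variable x W ->
  Q [set w | (W w < k)%N] = (pcdf x k)%:E.
Proof.
move=> x0 hW.
have AE a : (a < k)%N ->
    [set w | (W w < k)%N] `&` [set w | W w = a] = [set w | W w = a].
  by move=> ak; apply/setIidr => w /= ->.
have [||_ ->] := @measure_split_nat R d T Q k W [set w | (W w < k)%N].
- by [].
- by move=> a ak; rewrite AE //; exact: (@measurable_funPTI _ _ _ _ W [set a]%classic).
rewrite /pcdf -sumEFin; apply: eq_bigr => a _.
by rewrite (AE a) ?(ltn_ord a) // (hW a) poisson_pmfE.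
Qed.

Theorem theorem3 (R : realType) (N : nat) (Vmax Vmin : R)
    (hN : (1 <= N)%N) (hVmin : 0 < Vmin) (hV : Vmin < Vmax)
    (d : measure_display) (T : measurableType d) (Q : probability T R)
    (W : {RV Q >-> nat})
    (hW : poisson_variable (N%:R * ln (Vmax / Vmin)) W) :
  (forall F : reuse_scheme N Vmax Vmin,
     rs_P F [set w | total_original w = 0%N] = Q [set w | W w = 0%N] /\
     (forall k : nat, (0 < k)%N ->
        (Q [set w | (W w <= k)%N] <
         rs_P F [set w | (total_original w <= k)%N])%E)) /\
  (forall F : nat -> reuse_scheme N Vmax Vmin,
     max_volume_gap (F n) @[n --> \oo] --> (0 : R) ->
     cvg_in_distribution (fun n => rs_P (F n))
       (fun n w => (@total_original R N Vmax Vmin (F n) w)%:R : R)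
       Q (fun w => (W w)%:R : R)).
Proof.
have x0 : 0 < N%:R * ln (Vmax / Vmin).
  by rewrite mulr_gt0 ?ltr0n // ln_gt0 // ltr_pdivlMr // mul1r.
split=> [F|F gap0].
  split=> [|k k0].
    have -> : [set w | total_original w = 0%N] =
        [set w : rs_T F | (total_original w < 1)%N].
      by apply/seteqP; split=> w /=; rewrite ltnS leqn0 => /eqP.
    rewrite total_original_cdf // bern_cdf1 ?log_rate_ratios ?ratios_bounds //.
    by rewrite hW poisson_pmfE // pcdfS pcdf0 add0r.
  rewrite (poisson_variable_cdf _ _ _ _ _ _ k.+1 x0 hW).
  rewrite (total_original_cdf F hN hVmin k.+1) lte_fin -(log_rate_ratios F) //.
  by apply: pcdf_lt_bern_cdf; rewrite ?ratios_bounds ?ratios_lt1.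
(* For negative [x] all the distribution functions vanish; for [x >= 0] the threshold is the integer
   [Num.truncn x + 1], with strict inequality. *)
move=> x _; have [x_lt0|x_ge0] := ltP x 0.
  have empty (U : Type) (f : U -> nat) : [set w | (f w)%:R <= x] = set0.
    apply/seteqP; split=> // w /= /le_lt_trans /(_ x_lt0).
    by rewrite ltNge ler0n.
  rewrite empty measure0; apply: cvg_near_cst.
  by apply: nearW => n; rewrite empty measure0.
have cdfE (U : Type) (f : U -> nat) :
    [set w | (f w)%:R <= x] = [set w | (f w < (Num.truncn x).+1)%N].
  by apply/seteqP; split=> w /=; rewrite ltnS truncn_ge_nat.
rewrite cdfE (poisson_variable_cdf _ _ _ _ _ _ _ x0 hW).
under eq_fun do rewrite cdfE total_original_cdf //.
apply: cvg_EFin; first exact: nearW.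
set k := (Num.truncn x).+1; set C := N%:R * (Vmax - Vmin) / Vmin ^+ 2.
(* [C] depends only on [N], [Vmax] and [Vmin], so the upper bound tends to the Poisson value as the
   gap tends to 0. *)
apply: (@squeeze_cvgr _ _ _ _
  (fun=> pcdf (N%:R * ln (Vmax / Vmin)) k)
  (fun n => pcdf (N%:R * ln (Vmax / Vmin)) k + max_volume_gap (F n) * C)).
- apply: nearW => n /=; rewrite -(log_rate_ratios (F n)) //.
  rewrite pcdf_le_bern_cdf ?ratios_bounds //=.
  apply: le_trans (bern_cdf_le_pcdf _ _ (ratios_bounds _ _ _)) _ => //.
  by rewrite lerD2l sum_sqr_ratios.
- exact: cvg_cst.
- rewrite -[X in _ --> X]addr0 -[X in _ --> _ + X](mul0r C).
  by apply: cvgD; [exact: cvg_cst | apply: cvgMl].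
Qed.
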